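(* Let $G$ be a connected graph with maximum degree $\Delta$. Then $$\sqrt{2}\,R(G)\leq BSO(G)\leq \sqrt{2}\,\Delta\, M_2^{*}(G),$$ with equality (in either inequality) if and only if $G$ is a regular graph.
   Context: Graphs are finite, simple and undirected. For a connected graph $G$ with edge set $E(G)$, $d_v$ denotes the degree of the vertex $v$ in $G$. The first Banhatti-Sombor index is $BSO(G)=\sum_{uv\in E(G)}\sqrt{\frac{1}{d_u^2}+\frac{1}{d_v^2}}$, the Randić index is $R(G)=\sum_{uv\in E(G)}\frac{1}{\sqrt{d_ud_v}}$, and the modified second Zagreb index is $M_2^{*}(G)=\sum_{uv\in E(G)}\frac{1}{d_ud_v}$. *)

(* Defs.v *)
From mathcomp Require Import all_boot all_order all_algebra.

Set Implicit Arguments.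
Unset Strict Implicit.
Unset Printing Implicit Defensive.

Import Order.TTheory GRing.Theory Num.Theory.

Local Open Scope ring_scope.

Definition simple_graph (T : finType) (adj : rel T) : Prop :=
  symmetric adj /\ irreflexive adj.

Definition connected_graph (T : finType) (adj : rel T) : Prop :=
  (0 < #|T|)%N /\ forall x y : T, connect adj x y.

Definition deg (T : finType) (adj : rel T) (v : T) : nat :=
  #|[set w | adj v w]|.

Definition max_degree (T : finType) (adj : rel T) : nat :=
  \max_(v : T) deg adj v.

Definition regular_graph (T : finType) (adj : rel T) : Prop :=
  exists k : nat, forall v : T, deg adj v = k.

Definition edges (T : finType) (adj : rel T) : {set {set T}} :=
  [set e : {set T} | [exists u, exists v, adj u v && (e == [set u; v])]].

(* An edge uv is the two-element set [set u; v], so an expression symmetric  *)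
(* in its endpoints is a sum or product over v in e: for instance            *)
(* d_u * d_v is \prod_(v in e) d_v.                                          *)

Definition banhatti_sombor (R : rcfType) (T : finType) (adj : rel T) : R :=
  \sum_(e in edges adj) Num.sqrt (\sum_(v in e) 1 / (deg adj v)%:R ^+ 2).

Definition randic (R : rcfType) (T : finType) (adj : rel T) : R :=
  \sum_(e in edges adj) 1 / Num.sqrt (\prod_(v in e) (deg adj v)%:R).

Definition modified_zagreb2 (R : rcfType) (T : finType) (adj : rel T) : R :=
  \sum_(e in edges adj) 1 / \prod_(v in e) (deg adj v)%:R.

(* Main.v *)
Require Import Defs.
From mathcomp Require Import all_boot all_order all_algebra.
From mathcomp Require Import ring.

Set Implicit Arguments.
Unset Strict Implicit.
Unset Printing Implicit Defensive.

Import Order.TTheory GRing.Theory Num.Theory.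

Local Open Scope ring_scope.

(** Both inequalities hold edge by edge.  For an edge with end degrees [p] and
    [q], the lower bound is the inequality [2 x y <= x ^+ 2 + y ^+ 2] at
    [x = 1 / p] and [y = 1 / q], under a square root; it is an equality exactly
    when [p = q] ([leif_randic_edge]).  For the upper bound, the summand
    [sqrt (1 / p ^+ 2 + 1 / q ^+ 2)] is [sqrt (p ^+ 2 + q ^+ 2) / (p * q)], and
    both degrees are at most the maximum degree [D]; equality holds exactly
    when [p = q = D] ([leif_zagreb2_edge]).

    Since a sum of termwise inequalities is an equality exactly when each of
    them is, equality in the lower bound means that adjacent vertices have the
    same degree, and equality in the upper bound means that the endpoints of
    every edge have degree [D].  Connectedness turns either condition into
    regularity ([regular_graphP]).  Conversely the common degree of a regular
    graph is its maximum degree, because the graph has a vertex.  The graph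
    with one vertex has no edge, so that all three indices vanish, and it is
    regular. *)

Lemma leif_sqrt (R : rcfType) (a b : R) (C : bool) :
  0 <= a -> a <= b ?= iff C -> Num.sqrt a <= Num.sqrt b ?= iff C.
Proof.
move=> a0 ab; have b0 : 0 <= b by apply: le_trans a0 ab.1.
split; first by rewrite ler_sqrt // ab.1.
by rewrite eqr_sqrt // ab.2.
Qed.

(** Under the square roots this is the comparison of the geometric and quadratic
    means of [1 / p] and [1 / q]. *)
Lemma leif_randic_edge (R : rcfType) (p q : R) :
  0 < p -> 0 < q ->
  Num.sqrt 2 * (1 / Num.sqrt (p * q))
    <= Num.sqrt (1 / p ^+ 2 + 1 / q ^+ 2) ?= iff (p == q).
Proof.
move=> p0 q0; have pq0 : 0 < p * q by rewrite mulr_gt0.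
rewrite !div1r -sqrtrV ?ltW // -sqrtrM ?ler0n //; apply: leif_sqrt.
  by rewrite mulr_ge0 // invr_ge0 ltW.
have := leif_mean_square p^-1 q^-1.
rewrite (inj_eq (@invr_inj R)) -!exprVn invfM => -[le_xy eq_xy].
split; first by rewrite mulrC -ler_pdivlMr.
have n2 : 2 != 0 :> R by rewrite pnatr_eq0.
by rewrite -eq_xy mulrC -[RHS](inj_eq (mulIf n2)) divfK.
Qed.

(** With the common factor [1 / (p * q)] taken out of both sides, what remains
    is [sqrt (p ^+ 2 + q ^+ 2) <= sqrt (D ^+ 2 + D ^+ 2)]. *)
Lemma leif_zagreb2_edge (R : rcfType) (p q D : R) :
  0 < p <= D -> 0 < q <= D ->
  Num.sqrt (1 / p ^+ 2 + 1 / q ^+ 2)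
    <= Num.sqrt 2 * D * (1 / (p * q)) ?= iff (p == D) && (q == D).
Proof.
move=> /andP[p0 pD] /andP[q0 qD]; have D0 : 0 < D by apply: lt_le_trans pD.
have leif_sqr x : 0 < x -> x <= D -> x ^+ 2 <= D ^+ 2 ?= iff (x == D).
  move=> x0 xD; split; first by rewrite ler_pXn2r ?nnegrE ?(ltW x0) ?(ltW D0).
  by rewrite eqrXn2 ?(ltW x0) ?(ltW D0).
have pq0 : 0 < p * q by rewrite mulr_gt0.
have -> : 1 / p ^+ 2 + 1 / q ^+ 2 = (p ^+ 2 + q ^+ 2) * (p * q) ^- 2.
  by field; rewrite !gt_eqF.
have -> : Num.sqrt 2 * D * (1 / (p * q)) =
          Num.sqrt (D ^+ 2 + D ^+ 2) * Num.sqrt ((p * q) ^- 2) :> R.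
  rewrite -mulr2n -[D ^+ 2 *+ 2]mulr_natl sqrtrM ?ler0n //.
  rewrite sqrtr_sqr gtr0_norm //.
  by rewrite sqrtrV ?sqr_ge0 // sqrtr_sqr gtr0_norm // div1r.
have s0 : 0 <= p ^+ 2 + q ^+ 2 by rewrite addr_ge0 ?sqr_ge0.
rewrite sqrtrM //.
have w0 : 0 < Num.sqrt ((p * q) ^- 2) by rewrite sqrtr_gt0 invr_gt0 exprn_gt0.
have le_s := leif_sqrt s0 (leifD (leif_sqr p p0 pD) (leif_sqr q q0 qD)).
split; first by rewrite ler_pM2r // le_s.1.
by rewrite (inj_eq (mulIf (lt0r_neq0 w0))) le_s.2.
Qed.

Section Graph.

Variables (T : finType) (adj : rel T).

Lemma edgesP (e : {set T}) :
  reflect (exists u v, adj u v /\ e = [set u; v]) (e \in edges adj).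
Proof.
rewrite inE; apply: (iffP existsP) => [[u /existsP[v /andP[uv /eqP ->]]]|].
  by exists u, v.
by case=> u [v [uv ->]]; exists u; apply/existsP; exists v; rewrite uv eqxx.
Qed.

Lemma deg_gt0 (u v : T) : adj u v -> (0 < deg adj u)%N.
Proof. by move=> uv; apply/card_gt0P; exists v; rewrite inE. Qed.

Lemma deg_le_max (v : T) : (deg adj v <= max_degree adj)%N.
Proof. exact: leq_bigmax. Qed.

Lemma forall_in_set2 (P : pred T) (u v : T) :
  [forall x in [set u; v], P x] = P u && P v.
Proof.
apply/forall_inP/andP => [P_uv | [Pu Pv] x].
  by split; apply: P_uv; rewrite !inE eqxx ?orbT.
by rewrite !inE => /orP[] /eqP ->.
Qed.

(** Degrees are constant along paths as soon as they agree across edges. *)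
Lemma regular_graphP :
  connected_graph adj ->
  regular_graph adj <-> (forall u v, adj u v -> deg adj u = deg adj v).
Proof.
move=> [/card_gt0P[x0 _] conn]; split=> [[k deg_k] u v _|deg_adj].
  by rewrite !deg_k.
exists (deg adj x0) => v; have /connectP[p] := conn v x0.
elim: p v => [|w p IHp] v /= => [_ -> //|/andP[vw path_p] last_p].
by rewrite (deg_adj v w vw) (IHp w).
Qed.

(** The vertex [v] bounds the common degree by the maximum, so that the junk
    value [0] of a maximum over no vertex does not occur. *)
Lemma regular_max_degree (v : T) :
  regular_graph adj -> deg adj v = max_degree adj.
Proof.
move=> [k deg_k]; apply/eqP; rewrite eqn_leq deg_le_max /=.
by apply/bigmax_leqP => w _; rewrite !deg_k.
Qed.

End Graph.

Theorem theorem3p8 (R : rcfType) (T : finType) (adj : rel T)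
    (Hsimple : simple_graph adj) (Hconn : connected_graph adj) :
  [/\ Num.sqrt 2 * randic R adj <= banhatti_sombor R adj,
      banhatti_sombor R adj
        <= Num.sqrt 2 * (max_degree adj)%:R * modified_zagreb2 R adj,
      Num.sqrt 2 * randic R adj = banhatti_sombor R adj
        <-> regular_graph adj
    & banhatti_sombor R adj
        = Num.sqrt 2 * (max_degree adj)%:R * modified_zagreb2 R adj
        <-> regular_graph adj].
Proof.
case: Hsimple => sym_adj irr_adj.
have neq_adj u v : adj u v -> u != v.
  by apply: contraTneq => ->; rewrite irr_adj.
have deg_pos u v : adj u v -> 0 < (deg adj u)%:R :> R.
  by move=> uv; rewrite ltr0n (deg_gt0 uv).
have deg_max u : (deg adj u)%:R <= (max_degree adj)%:R :> R.
  by rewrite ler_nat deg_le_max.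
(* [leif_sum] carries the equality cases along: the sums agree exactly when
   the summands do on every edge. *)
have low : Num.sqrt 2 * randic R adj <= banhatti_sombor R adj
    ?= iff [forall (e | e \in edges adj),
             [forall u in e, [forall v in e, deg adj u == deg adj v]]].
  rewrite mulr_sumr; apply: leif_sum => _ /edgesP[u [v [uv ->]]].
  rewrite !forall_in_set2 !eqxx [deg adj v == _]eq_sym andbT andbb.
  rewrite !big_setU1 ?inE ?neq_adj // !big_set1 -(eqr_nat R).
  by apply: leif_randic_edge; apply: deg_pos; last rewrite sym_adj; apply: uv.
have up : banhatti_sombor R adj
      <= Num.sqrt 2 * (max_degree adj)%:R * modified_zagreb2 R adj
    ?= iff [forall (e | e \in edges adj),
             [forall v in e, deg adj v == max_degree adj]].
  rewrite mulr_sumr; apply: leif_sum => _ /edgesP[u [v [uv ->]]].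
  rewrite forall_in_set2 !big_setU1 ?inE ?neq_adj // !big_set1 -!(eqr_nat R).
  have vu : adj v u by rewrite sym_adj.
  apply: leif_zagreb2_edge; rewrite deg_max andbT.
    exact: deg_pos uv.
  exact: deg_pos vu.
have edge_in u v : adj u v -> [set u; v] \in edges adj.
  by move=> uv; apply/edgesP; exists u, v.
split; [exact: low.1 | exact: up.1 | |].
  split=> [/eqP|reg].
    rewrite low.2 => /forall_inP deg_e; apply/regular_graphP => // u v uv.
    have := deg_e _ (edge_in u v uv).
    by rewrite !forall_in_set2 => /andP[/andP[_ /eqP]].
  apply/eqP; rewrite low.2; apply/forall_inP => e _.
  apply/forall_inP => u _; apply/forall_inP => v _.
  by rewrite !regular_max_degree.
split=> [/eqP|reg].
  rewrite up.2 => /forall_inP deg_e; apply/regular_graphP => // u v uv.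
  have := deg_e _ (edge_in u v uv).
  by rewrite forall_in_set2 => /andP[/eqP -> /eqP ->].
apply/eqP; rewrite up.2; apply/forall_inP => e _.
by apply/forall_inP => v _; rewrite regular_max_degree.
Qed.
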